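(* For $0<p\le q$, define, for bounded measurable $h:\mathbb{R}\to\mathbb{R}$, $$K_{p,q}h(x)=\mathbb{E}\,h(V_{p,q}x),\qquad x\in\mathbb{R},$$ where $V_{p,q}$ has the unique factor law from $X_q$ to $X_p$. Then $K_{p,q}$ is a Markov operator and $$\mathbb{E}\,h(X_p)=\mathbb{E}\,K_{p,q}h(X_q)$$ for every bounded measurable $h$. Moreover, for $0<p\le q\le r$, the operators compose on bounded measurable test functions $h$ according to $$K_{q,r}(K_{p,q}h)=K_{p,r}h,$$ where the composition is evaluated using independent copies of the factor laws.
   Context: For $r>0$, $X_r\sim N_r(0,1)$ means that $X_r$ is a real random variable with density $$f_r(x)=\frac{r}{2^{1+1/r}\Gamma(1/r)}\exp\left(-\frac{|x|^r}{2}\right),\qquad x\in\mathbb{R}.$$ For $0<p\le q$, the factor law from $X_q$ to $X_p$ is the law of a strictly positive random variable $V_{p,q}$, independent of $X_q$, such that $V_{p,q}X_q\stackrel{d}{=}X_p$; such a law exists and is unique. A Markov operator here is a linear operator $K$ mapping bounded measurable functions on $\mathbb{R}$ to bounded measurable functions on $\mathbb{R}$, with $K1=1$ and $Kh\ge0$ whenever $h\ge0$. *)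

(* Defs.v *)
From mathcomp Require Export all_boot all_order all_algebra.
From mathcomp Require Export all_classical all_reals all_analysis.
Export Order.TTheory GRing.Theory Num.Theory.
Export numFieldNormedType.Exports.

Set Implicit Arguments.
Unset Strict Implicit.
Unset Printing Implicit Defensive.

Local Open Scope classical_set_scope.
Local Open Scope ring_scope.

Definition Gamma (R : realType) (s : R) : R :=
  \int[lebesgue_measure]_(t in `]0, +oo[) (t `^ (s - 1) * expR (- t)).

Definition gg_density (R : realType) (r x : R) : R :=
  r / (2 `^ (1 + r^-1) * Gamma r^-1) * expR (- (`|x| `^ r / 2)).

(* X ~ N_r(0, 1) *)
Definition gg_distributed (R : realType) (r : R) (d : measure_display)
    (T : measurableType d) (P : probability T R) (X : {RV P >-> R}) : Prop :=
  forall A : set R, measurable A ->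
    distribution P X A =
    (\int[lebesgue_measure]_(x in A) (gg_density r x)%:E)%E.

Definition has_law (R : realType) (d : measure_display) (T : measurableType d)
    (P : probability T R) (X : {RV P >-> R})
    (mu : probability R R) : Prop :=
  forall A : set R, measurable A -> distribution P X A = mu A.

Definition independent (R : realType) (d : measure_display)
    (T : measurableType d) (P : probability T R) (X Y : {RV P >-> R}) : Prop :=
  forall A B : set R, measurable A -> measurable B ->
    P (X @^-1` A `&` Y @^-1` B) = (P (X @^-1` A) * P (Y @^-1` B))%E.

Definition factor_law (R : realType) (p q : R)
    (mu : probability R R) : Prop :=
  exists (d : measure_display) (T : measurableType d) (P : probability T R)
    (V Xq Xp : {RV P >-> R}),
    [/\ has_law V mu, (forall w, 0 < V w), gg_distributed q Xq,
        independent V Xq &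
        gg_distributed p Xp /\ (forall w, Xp w = V w * Xq w)].

Definition bounded_measurable (R : realType) (h : R -> R) : Prop :=
  measurable_fun [set: R] h /\ [bounded h x | x in [set: R]].

(* An operator on bounded measurable functions is encoded as a map on all
   functions; only its values at bounded measurable arguments matter. *)
Definition markov_operator (R : realType) (K : (R -> R) -> (R -> R)) : Prop :=
  [/\ (forall h, bounded_measurable h -> bounded_measurable (K h)),
      (forall (a : R) (g h : R -> R),
         bounded_measurable g -> bounded_measurable h ->
         forall x, K (fun y => a * g y + h y) x = a * K g x + K h x),
      (forall x, K (fun=> 1) x = 1) &
      (forall h, bounded_measurable h -> (forall x, 0 <= h x) ->
         forall x, 0 <= K h x)].

(* h |-> (x |-> E h(V x)) for V of law mu, realized as the identity on
   (R, mu); the expectation is finite whenever h is bounded measurable. *)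
Definition factor_operator (R : realType)
    (mu : probability R R) (h : R -> R) (x : R) : R :=
  fine ('E_mu[fun v : R => h (v * x)%R])%E.

(* Main.v *)
(* Fubini turns independence into composition of factor operators, so
   K_{q,r} K_{p,q} is the factor operator of the law rho of a product of
   independent factors, and rho mixes the scales of X_r into the law of X_p.
   What remains is that the mixing law mu on (0, oo) is determined by the law
   of V X_r.  Comparing the masses of small intervals recovers, for t > 0, the
   integrals of v^-1 exp (- t v^-r) against mu; these are Laplace transforms in
   u = v^-r.  Polynomials in y = exp (- tau u) without constant term that
   converge to the indicator of y >= 1/2 then give the integrals of v^-1 over
   [b, oo), and integrating over b (Tonelli) gives the tails of mu. *)
From HB Require Import structures.
Require Import Defs.
From mathcomp Require Import measurable_realfun ring lra.
Set Implicit Arguments.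
Unset Strict Implicit.
Unset Printing Implicit Defensive.

Local Open Scope classical_set_scope.
Local Open Scope ring_scope.

(** * Factor operators *)

(** Trades the eventual form of boundedness in [bounded_measurable] for one explicit bound valid at
    every point. *)
Lemma bounded_measurableP (R : realType) (h : R -> R) :
  bounded_measurable h <->
  measurable_fun [set: R] h /\ exists M, forall x, `|h x| <= M.
Proof.
split=> -[mh bh]; split=> //.
- by have [M _ hM] := ex_strict_bound_gt0 bh; exists M => x; rewrite ltW// hM.
- case: bh => M hM; exists M; split; first exact: num_real.
  by move=> N MN x _ /=; rewrite (le_trans (hM x))// ltW.
Qed.

Lemma bounded_measurable_comp (R : realType) (h f : R -> R) :
  bounded_measurable h -> measurable_fun setT f ->
  bounded_measurable (h \o f).
Proof.
move=> /bounded_measurableP[mh [M hM]] mf; apply/bounded_measurableP.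
by split; [exact: measurableT_comp|exists M => x; exact: hM].
Qed.

Lemma bounded_measurable_integrable (R : realType) d (T : measurableType d)
    (P : probability T R) (f : T -> R) (h : R -> R) :
  bounded_measurable h -> measurable_fun setT f ->
  P.-integrable setT (fun w => (h (f w))%:E).
Proof.
move=> /bounded_measurableP[mh [M hM]] mf.
apply: (@measurable_bounded_integrable _ _ _ _ (h \o f)) => //.
- by rewrite -ge0_fin_numE// fin_num_measure.
- exact: measurableT_comp.
- exists M; split; first exact: num_real.
  by move=> N MN x _ /=; rewrite (le_trans (hM _))// ltW.
Qed.

(** [fine] loses nothing, since a bounded integrand has a finite integral under a probability.
    Identities can thus be proved between extended real integrals, where Fubini applies. *)
Lemma factor_operatorE (R : realType) (mu : probability R R) h x :
  bounded_measurable h ->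
  (factor_operator mu h x)%:E = (\int[mu]_v (h (v * x))%:E)%E.
Proof.
move=> bh; rewrite /factor_operator unlock fineK//.
apply: integrable_fin_num => //.
apply: (bounded_measurable_integrable _ bh).
exact: measurable_funM.
Qed.

Lemma law_integral (R : realType) d (T : measurableType d)
    (P : probability T R) (X : {RV P >-> R}) (mu : probability R R)
    (h : R -> R) : has_law X mu -> bounded_measurable h ->
  (\int[P]_w (h (X w))%:E = \int[mu]_v (h v)%:E)%E.
Proof.
move=> Xmu bh.
rewrite -(integral_distribution (f := EFin \o h)); first last.
- exact: bounded_measurable_integrable.
- by apply/measurable_EFinP; case: bh.
by apply: eq_measure_integral => A mA _; exact: Xmu.
Qed.

(** By independence the joint law of [(X, Y)] agrees with [mu \x nu] on rectangles, hence
    everywhere; Fubini then integrates first over the value of [X]. *)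
Lemma independent_integral_mul (R : realType) d (T : measurableType d)
    (P : probability T R) (X Y : {RV P >-> R}) (mu nu : probability R R)
    (h : R -> R) : has_law X mu -> has_law Y nu -> independent X Y ->
  bounded_measurable h ->
  (\int[P]_w (h (X w * Y w))%:E = \int[nu]_y (factor_operator mu h y)%:E)%E.
Proof.
move=> Xmu Ynu XY bh.
have mXY : measurable_fun setT (fun w => (X w, Y w)).
  exact: measurable_fun_pair.
pose XY_mixin := isMeasurableFun.Build _ _ _ _ _ mXY.
pose XY_mfun : {mfun T >-> (R * R)%type} := HB.pack (fun w => (X w, Y w)) XY_mixin.
have mM : measurable_fun setT (fun z : R * R => z.1 * z.2) by exact: measurable_funM.
pose f (z : R * R) := (h (z.1 * z.2))%:E.
have mf : measurable_fun setT f.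
  apply/measurable_EFinP; apply: (@measurableT_comp _ _ _ _ _ _ h) => //.
  by case: bh.
have fi : (mu \x nu)%E.-integrable setT f by exact: bounded_measurable_integrable.
transitivity (\int[mu \x nu]_z f z)%E; last first.
  rewrite -integral21_prod_meas1//.
  by apply: eq_integral => y _; rewrite factor_operatorE.
rewrite -[LHS](integral_pushforward mXY mf _ measurableT); last first.
  by apply: (bounded_measurable_integrable _ bh); exact: measurable_funM.
apply: (@eq_measure_integral _ _ _ _ (mu \x nu)%E (distribution P XY_mfun)).
move=> A mA _; apply/esym; apply: (product_measure_unique) => // B C mB mC.
transitivity (distribution P X B * distribution P Y C)%E; first exact: XY.
by rewrite Xmu// Ynu.
Qed.

Lemma factor_operator_markov (R : realType) (mu : probability R R) :
  markov_operator (factor_operator mu).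
Proof.
split.
- move=> h bh; apply/bounded_measurableP; split.
    apply/measurable_EFinP.
    rewrite (_ : _ \o _ = fun x => (\int[mu]_v (h (v * x))%:E)%E); last first.
      by apply/funext => x; rewrite /= factor_operatorE.
    (* The inner integral is taken against [m1]; the measure [m2] on the variable x only serves to
       express integrability on the product, so [mu] is reused. *)
    apply: (measurable_fubini_G (m1 := mu) (m2 := mu)
      (f := fun z => (h (z.1 * z.2))%:E)).
    by apply: (bounded_measurable_integrable _ bh); exact: measurable_funM.
  have /bounded_measurableP[mh [M hM]] := bh; exists M => x.
  have mx : measurable_fun setT (fun v : R => v * x) by exact: measurable_funM.
  have ih := bounded_measurable_integrable mu bh mx.
  rewrite -lee_fin -abse_EFin factor_operatorE//.
  apply: (le_trans (le_abse_integral mu measurableT (measurable_int mu ih))).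
  apply: (@le_trans _ _ (\int[mu]_v (cst M%:E v))%E).
    apply: ge0_le_integral => //.
    + by apply: measurableT_comp => //; exact: measurable_int ih.
    + by move=> v _ /=; rewrite lee_fin.
  by rewrite integral_cst// [X in (_ * X)%E](probability_setT mu) mule1.
- move=> a g h bg bh x.
  have bagh : bounded_measurable (fun y => a * g y + h y).
    move/bounded_measurableP: bg => [mg [M gM]].
    move/bounded_measurableP: bh => [mh [N hN]].
    apply/bounded_measurableP; split.
      by apply: measurable_funD => //; exact: measurable_funM.
    exists (`|a| * M + N) => y; rewrite (le_trans (ler_normD _ _))// lerD//.
    by rewrite normrM ler_wpM2l.
  apply: EFin_inj; rewrite factor_operatorE//.
  rewrite EFinD EFinM !factor_operatorE//.
  have mx : measurable_fun setT (fun v : R => v * x) by exact: measurable_funM.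
  rewrite -integralZl//; last exact: bounded_measurable_integrable.
  rewrite -integralD//; last 2 first.
    by apply: integrableZl => //; exact: bounded_measurable_integrable.
    exact: bounded_measurable_integrable.
- move=> x; rewrite /factor_operator unlock.
  by rewrite integral_cst// [X in (_ * X)%E](probability_setT mu) mule1.
- move=> h bh h0 x; rewrite /factor_operator unlock.
  by apply/fine_ge0/integral_ge0 => v _; rewrite lee_fin.
Qed.

(** * Composition of factor operators *)

Lemma bounded_measurable_scale (R : realType) (h : R -> R) (x : R) :
  bounded_measurable h -> bounded_measurable (fun v => h (v * x)).
Proof.
move=> bh; apply: (bounded_measurable_comp (f := *%R^~ x) bh).
exact: measurable_funM.
Qed.

(** Absorbs the point of evaluation into the test function, so that results on a product of two
    factors apply at every x. *)
Lemma factor_operator_scale (R : realType) (mu : probability R R) h (x y : R) :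
  factor_operator mu (fun v => h (v * x)) y = factor_operator mu h (y * x).
Proof.
rewrite /factor_operator unlock; congr fine.
by apply: eq_integral => v _; rewrite mulrA.
Qed.

(** The witness [rho] is the law of the product of the two coordinates on the plane with measure
    [mu \x nu], where the coordinates are independent with laws [mu] and [nu]. *)
Lemma factor_operator_comp (R : realType) (mu nu : probability R R) :
  mu `]0%R, +oo[%classic = 1%E -> nu `]0%R, +oo[%classic = 1%E ->
  exists2 rho : probability R R, rho `]0%R, +oo[%classic = 1%E &
  forall h x, bounded_measurable h ->
  factor_operator rho h x = factor_operator nu (factor_operator mu h) x.
Proof.
move=> mu1 nu1.
pose P : probability (R * R)%type R := (mu \x nu)%E.
have m1 : measurable_fun setT (@fst R R) by exact: measurable_fst.
have m2 : measurable_fun setT (@snd R R) by exact: measurable_snd.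
have m12 : measurable_fun setT (fun z : R * R => z.1 * z.2).
  exact: measurable_funM.
pose mix1 := isMeasurableFun.Build _ _ _ _ _ m1.
pose X : {RV P >-> R} := HB.pack (@fst R R) mix1.
pose mix2 := isMeasurableFun.Build _ _ _ _ _ m2.
pose Y : {RV P >-> R} := HB.pack (@snd R R) mix2.
pose mix12 := isMeasurableFun.Build _ _ _ _ _ m12.
pose XY : {RV P >-> R} := HB.pack (fun z : R * R => z.1 * z.2) mix12.
have PX A B : measurable A -> measurable B -> P (A `*` B) = (mu A * nu B)%E.
  by move=> mA mB; rewrite [LHS]product_measure1E.
have lX : has_law X mu.
  move=> A mA; transitivity (P (A `*` setT)).
    by congr (P _); apply/seteqP; split => z //= [].
  by rewrite PX// probability_setT mule1.
have lY : has_law Y nu.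
  move=> A mA; transitivity (P (setT `*` A)).
    by congr (P _); apply/seteqP; split => z //= [].
  by rewrite PX// probability_setT mul1e.
have iXY : independent X Y.
  move=> A B mA mB; transitivity (P (A `*` B)).
    by congr (P _); apply/seteqP; split => z //= [].
  rewrite PX// -(lX _ mA) -(lY _ mB) //.
exists (distribution P XY).
  apply/eqP; rewrite eq_le probability_le1//=.
  (* The open quadrant already has mass 1, and products of its points are positive. *)
  apply: (@le_trans _ _ (P (`]0, +oo[%classic `*` `]0, +oo[%classic))).
    by rewrite PX// mu1 nu1 mule1.
  apply: le_measure; rewrite ?inE//.
  - exact: measurableX.
  - by rewrite -[_ @^-1` _]setTI; exact: (m12).
  - by move=> z /=; rewrite !in_itv/= !andbT => -[? ?]; exact: mulr_gt0.
move=> h x bh.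
have bhx := bounded_measurable_scale x bh.
apply: EFin_inj; rewrite !factor_operatorE//; last first.
  by have [+ _ _ _] := factor_operator_markov mu; exact.
rewrite -[LHS](law_integral (X := XY) _ bhx)//.
rewrite [LHS](independent_integral_mul lX lY iXY bhx).
by apply: eq_integral => y _; rewrite factor_operator_scale.
Qed.

(** * Consequences of the factor law *)

(** Both sides depend only on the laws of [Xp] and [Xq], so these may be replaced by the coupled
    variables that the factor law provides, whatever their probability spaces. *)
Lemma factor_law_integral (R : realType) (p q : R) (mu : probability R R)
    (d1 : measure_display) (T1 : measurableType d1)
    (P1 : probability T1 R) (Xp : {RV P1 >-> R})
    (d2 : measure_display) (T2 : measurableType d2)
    (P2 : probability T2 R) (Xq : {RV P2 >-> R}) (h : R -> R) :
  factor_law p q mu -> gg_distributed p Xp -> gg_distributed q Xq ->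
  bounded_measurable h ->
  (\int[P1]_w (h (Xp w))%:E = \int[P2]_w (factor_operator mu h (Xq w))%:E)%E.
Proof.
move=> [d [T [P [V [Yq [Yp [Vmu V0 ggYq VYq [ggYp YpE]]]]]]]] ggXp ggXq bh.
have bKh : bounded_measurable (factor_operator mu h).
  by have [+ _ _ _] := factor_operator_markov mu; exact.
rewrite (law_integral (mu := distribution P Yp) _ bh); last first.
  by move=> A mA; exact: etrans (ggXp A mA) (esym (ggYp A mA)).
rewrite (law_integral (mu := distribution P Yq) _ bKh); last first.
  by move=> A mA; exact: etrans (ggXq A mA) (esym (ggYq A mA)).
rewrite -(independent_integral_mul Vmu _ VYq bh)//.
rewrite -(law_integral (X := Yp) _ bh)//.
by apply: eq_integral => w _; rewrite YpE.
Qed.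

Lemma factor_law_pos (R : realType) (p q : R) (mu : probability R R) :
  factor_law p q mu -> mu `]0%R, +oo[%classic = 1%E.
Proof.
move=> [d [T [P [V [Yq [Yp [Vmu V0 _ _ _]]]]]]].
rewrite -Vmu// -(probability_setT P); congr (P _).
by apply/seteqP; split => w //= _; rewrite in_itv/= V0.
Qed.

(** * Uniqueness of the mixing law *)

(* The factor [n.+1] in the exponent makes the value at [y = 1/2] tend to 1:
   with [2 ^ n.+1] alone it would tend to [1 - 1/e]. *)
Definition poly_step (R : realType) (n : nat) (y : R) : R :=
  1 - (1 - y ^+ n.+1) ^+ (n.+1 * 2 ^ n.+1).

Lemma subr1X_ge0_le1 (R : realType) (x : R) m :
  0 <= x <= 1 -> 0 <= (1 - x) ^+ m <= 1.
Proof.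
move=> /andP[x0 x1]; have x1' : 0 <= 1 - x by rewrite subr_ge0.
by rewrite exprn_ge0//= exprn_ile1// gerBl.
Qed.

Lemma bernoulli_subX (R : realType) (x : R) m :
  0 <= x <= 1 -> 1 - m%:R * x <= (1 - x) ^+ m.
Proof.
move=> x01; elim: m => [|m IH]; first by rewrite mul0r subr0 expr0.
have /andP[p0 p1] := subr1X_ge0_le1 m x01; case/andP: x01 => x0 x1.
rewrite exprSr -natr1; set p := (1 - x) ^+ m in IH p0 p1 *.
have : p * x <= x by rewrite ler_piMl.
by move: IH; lra.
Qed.

Lemma poly_step_ge0_le1 (R : realType) n (y : R) :
  0 <= y <= 1 -> 0 <= poly_step n y <= 1.
Proof.
move=> /andP[y0 y1].
have := @subr1X_ge0_le1 R (y ^+ n.+1) (n.+1 * 2 ^ n.+1).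
rewrite exprn_ge0//= exprn_ile1// => /(_ isT) /andP[a b].
by rewrite /poly_step subr_ge0 b gerBl a.
Qed.

(** This is Bernoulli's inequality for the exponent [n.+1 * 2 ^ n.+1]; the bound tends to 0 when y <
    1/2. *)
Lemma poly_step_le (R : realType) n (y : R) :
  0 <= y <= 1 -> poly_step n y <= n.+1%:R * (2 * y) ^+ n.+1.
Proof.
move=> /andP[y0 y1].
have := @bernoulli_subX R (y ^+ n.+1) (n.+1 * 2 ^ n.+1).
rewrite exprn_ge0//= exprn_ile1// => /(_ isT).
by rewrite /poly_step exprMn natrM natrX; lra.
Qed.

(** A bound uniform in n, which later supplies the dominating function. For y >= 1/4 the right side
    is at least 1; for y < 1/4 one factor 2y is kept and (n+1) / 2^n <= 2 bounds the rest. *)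
Lemma poly_step_le_linear (R : realType) n (y : R) :
  0 <= y <= 1 -> poly_step n y <= 4 * y.
Proof.
move=> y01; have /andP[y0 y1] := y01.
have [y4|y4] := lerP 4^-1 y.
  have /andP[_ s1] := poly_step_ge0_le1 n y01; apply: (le_trans s1).
  lra.
apply: (le_trans (poly_step_le n y01)).
rewrite exprS mulrCA [leRHS](_ : _ = 2 * y * 2); last by lra.
rewrite ler_wpM2l ?mulr_ge0//.
have : (2 * y) ^+ n <= 2^-1 ^+ n.
  by rewrite lerXn2r ?nnegrE ?mulr_ge0 ?invr_ge0//; lra.
move=> /(ler_wpM2l (ler0n _ n.+1)) /le_trans; apply.
rewrite exprVn ler_pdivrMr ?exprn_gt0// -exprS -natrX ler_nat.
by rewrite (leq_trans _ (ltnW (ltn_expl n.+1 _))).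
Qed.

Lemma poly_step_cvg (R : realType) (y : R) : 0 < y <= 1 ->
  poly_step n y @[n --> \oo] --> ((2^-1 <= y)%R%:R : R).
Proof.
move=> /andP[y0 y1]; have y01 : 0 <= y <= 1 by rewrite ltW.
have [y2|y2] := lerP 2^-1 y.
- have e1 : `|expR (-1) : R| < 1 by rewrite ger0_norm ?expR_ge0// expR_lt1; lra.
  apply: (@squeeze_cvgr _ _ _ _ (fun n => 1 - geometric 1 (expR (-1)) n) (cst 1)).
  + near=> n; have /andP[_ ->] := poly_step_ge0_le1 n y01; rewrite andbT.
    rewrite /poly_step lerD2l lerN2 /= mul1r.
    (* By 1 - s <= exp (- s), the power is at most exp (- (n+1) (2y)^(n+1)), and 2y >= 1 here. *)
    apply: (@le_trans _ _ (expR (- (y ^+ n.+1)) ^+ (n.+1 * 2 ^ n.+1))).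
      have y1n : 0 <= 1 - y ^+ n.+1 by rewrite subr_ge0 exprn_ile1// ltW.
      by rewrite lerXn2r ?nnegrE ?expR_ge0//; exact: expR_ge1Dx.
    rewrite -!expRM_natl ler_expR !mulrN mulr1 lerN2.
    rewrite natrM natrX -mulrA -exprMn.
    apply: (@le_trans _ _ (n.+1%:R * 1)); first by rewrite mulr1 ler_nat.
    by rewrite ler_wpM2l// exprn_ege1//; lra.
  + rewrite -[X in _ --> X](subr0 1); apply: cvgB; first exact: cvg_cst.
    exact: cvg_geometric.
  + exact: cvg_cst.
(* With 2y = exp (- x) = q^2, the power (2y)^(n+1) splits into two factors q^(n+1): one absorbs n+1,
   because exp s >= 1 + s, and the other tends to 0. *)
- pose x := - ln (2 * y); have x0 : 0 < x by rewrite oppr_gt0 ln_lt0//; lra.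
  have yE : 2 * y = expR (- x) by rewrite opprK lnK// posrE; lra.
  pose q := expR (- (x / 2)).
  have q1 : `|q| < 1 by rewrite ger0_norm ?expR_ge0// expR_lt1; lra.
  apply: (@squeeze_cvgr _ _ _ _ (cst 0) (geometric (2 / x) q)).
  + near=> n; have /andP[-> _] /= := poly_step_ge0_le1 n y01.
    apply: (le_trans (poly_step_le n y01)).
    have -> : (2 * y) = q * q by rewrite yE /q -expRD; congr expR; lra.
    rewrite exprMn mulrA.
    have nq : n.+1%:R * q ^+ n.+1 <= 2 / x.
      rewrite -expRM_natl mulrN expRN ler_pdivrMr ?expR_gt0//.
      rewrite -ler_pdivrMl ?divr_gt0// invf_div.
      have := expR_ge1Dx (n.+1%:R * (x / 2)); lra.
    apply: ler_pM => //; first by rewrite mulr_ge0// exprn_ge0 ?expR_ge0.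
      by rewrite exprn_ge0 ?expR_ge0.
    rewrite exprS ler_piMl ?exprn_ge0 ?expR_ge0// ltW//.
    by move: q1; rewrite ger0_norm ?expR_ge0.
  + exact: cvg_cst.
  + exact: cvg_geometric.
Unshelve. all: by end_near. Qed.

(** * Determination of a measure by its tails and Laplace transform *)

(** The half-lines [c, oo) are stable under intersection, generate the Borel sets and exhaust the
    line. For c <= 0 both tails equal 1 because the mass sits on the positive numbers. *)
Lemma positive_measure_unique (R : realType) (mu nu : probability R R) :
  mu `]0%R, +oo[%classic = 1%E -> nu `]0%R, +oo[%classic = 1%E ->
  (forall c, 0 < c -> mu `[c, +oo[%classic = nu `[c, +oo[%classic) ->
  forall A, measurable A -> mu A = nu A.
Proof.
move=> mu1 nu1 munu A mA.
have tail1 (rho : probability R R) c : rho `]0%R, +oo[%classic = 1%E -> c <= 0 ->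
    rho `[c, +oo[%classic = 1%E.
  move=> rho1 c0; apply/eqP; rewrite eq_le probability_le1//= -rho1.
  apply: le_measure; rewrite ?inE//.
  by move=> x /=; rewrite !in_itv/= !andbT => /ltW; exact: le_trans.
have munu' c : mu `[c, +oo[%classic = nu `[c, +oo[%classic.
  by have [/tail1 c0|] := leP c 0; [rewrite !c0|exact: munu].
apply: (measure_unique [set B | exists x : R, B = `[x, +oo[%classic]
  (fun n => `[- n%:R, +oo[%classic)) => //.
- exact: RGenCInfty.measurableE.
- move=> _ _ [a ->] [b ->]; exists (Num.max a b).
  by apply/seteqP; split => x /=; rewrite !in_itv/= !andbT ge_max => /andP.
- by move=> n; exists (- n%:R).
- apply/seteqP; split => // x _; exists (Num.bound `|x|) => //=.
  by rewrite in_itv/= andbT lerNl (le_trans (ler_norm _))// normrN ltW// archi_boundP.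
- by move=> _ [c ->]; exact: munu'.
- by move=> n; rewrite -ge0_fin_numE// fin_num_measure.
Qed.

(* For [v < 0], [v `^ (-1) = 1]; the kernel is only integrated over [v > 0]. *)
Definition laplace_kernel (R : realType) (r t v : R) : R :=
  v `^ (-1) * expR (- (t * v `^ (- r))).

(** Integrability is included so that the relation is stable under sums and differences. *)
Definition same_integral (R : realType) (mu nu : probability R R)
    (g : R -> R) : Prop :=
  [/\ mu.-integrable `]0%R, +oo[ (EFin \o g),
      nu.-integrable `]0%R, +oo[ (EFin \o g) &
      (\int[mu]_(v in `]0%R, +oo[) (g v)%:E =
       \int[nu]_(v in `]0%R, +oo[) (g v)%:E)%E].

Lemma laplace_kernel_ge0 (R : realType) (r t v : R) :
  0 <= laplace_kernel r t v.
Proof. by rewrite mulr_ge0 ?powR_ge0 ?expR_ge0. Qed.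

Lemma measurable_laplace_kernel (R : realType) (r t : R) (D : set R) :
  measurable_fun D (laplace_kernel r t).
Proof.
apply: (@measurable_funS _ _ _ _ setT) => //.
apply: measurable_funM; first exact: measurable_powR.
apply: measurableT_comp => //; apply: measurableT_comp => //.
by apply: measurable_funM => //; exact: measurable_powR.
Qed.

Lemma ler_laplace_kernel (R : realType) (r s t v : R) :
  s <= t -> laplace_kernel r t v <= laplace_kernel r s v.
Proof.
move=> st; rewrite ler_wpM2l ?powR_ge0// ler_expR lerN2.
by rewrite ler_wpM2r ?powR_ge0.
Qed.

(** Comparing masses of intervals only relates the transforms at two distinct levels s < t. Letting
    s increase to t by dominated convergence closes the gap. *)
Lemma laplace_le (R : realType) (r : R) (mu nu : probability R R) :
  (forall t : R, 0 < t ->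
    nu.-integrable `]0%R, +oo[ (EFin \o laplace_kernel r t)) ->
  (forall s t : R, 0 < s -> s < t ->
    (\int[mu]_(v in `]0%R, +oo[) (laplace_kernel r t v)%:E <=
     \int[nu]_(v in `]0%R, +oo[) (laplace_kernel r s v)%:E)%E) ->
  forall t : R, 0 < t ->
    (\int[mu]_(v in `]0%R, +oo[) (laplace_kernel r t v)%:E <=
     \int[nu]_(v in `]0%R, +oo[) (laplace_kernel r t v)%:E)%E.
Proof.
move=> inu le t t0.
(* This sequence stays in [t/2, t), so the kernel at t/2 dominates all the others. *)
pose s n := t - t / 2 * harmonic n.
have h01 n : 0 < (harmonic n : R) <= 1.
  by rewrite harmonic_gt0/= invf_le1// ler1n.
have t20 : 0 < t / 2 by rewrite divr_gt0.
have s_ge n : t / 2 <= s n.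
  have /andP[_ h1] := h01 n.
  by have := ler_wpM2l (ltW t20) h1; rewrite /s; lra.
have s_lt n : s n < t.
  by have /andP[h0 _] := h01 n; rewrite /s gtrBl mulr_gt0.
have s_cvg : s n @[n --> \oo] --> t.
  rewrite -[X in _ --> X](subr0 t) -(mulr0 (t / 2)).
  apply: cvgB; first exact: cvg_cst.
  by apply: cvgMr; exact: cvg_harmonic.
have [] := @dominated_convergence _ _ _ nu `]0%R, +oo[%classic _
  (fun n v => (laplace_kernel r (s n) v)%:E)
  (fun v => (laplace_kernel r t v)%:E)
  (fun v => (laplace_kernel r (t / 2) v)%:E).
- exact: measurable_itv.
- by move=> n; apply/measurable_EFinP; exact: measurable_laplace_kernel.
- by apply/measurable_EFinP; exact: measurable_laplace_kernel.
- apply: aeW => v _ ; apply: cvg_EFin; first exact: nearW.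
  apply: cvgMr.
  apply: (cvg_comp (fun n => - (s n * v `^ (- r))) expR); last first.
    exact: continuous_expR.
  by apply: cvgN; apply: cvgMl.
- exact: inu.
- apply: aeW => v n _; rewrite gee0_abs lee_fin ?laplace_kernel_ge0//.
  exact: ler_laplace_kernel.
move=> _ _ lim; rewrite -(cvg_lim _ lim)//; apply: lime_ge.
  exact: cvgP lim.
apply: nearW => n; apply: le => //; exact: lt_le_trans (s_ge n).
Qed.

Lemma same_integralD (R : realType) (mu nu : probability R R) (f g : R -> R) :
  same_integral mu nu f -> same_integral mu nu g ->
  same_integral mu nu (fun v => f v + g v).
Proof.
move=> [fm fn fE] [gm gn gE]; split.
- exact: (integrableD (measurable_itv _) fm gm).
- exact: (integrableD (measurable_itv _) fn gn).
- under eq_integral do rewrite EFinD.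
  rewrite integralD// fE gE -integralD//.
Qed.

Lemma same_integralB (R : realType) (mu nu : probability R R) (f g : R -> R) :
  same_integral mu nu f -> same_integral mu nu g ->
  same_integral mu nu (fun v => f v - g v).
Proof.
move=> [fm fn fE] [gm gn gE]; split.
- exact: (integrableB (measurable_itv _) fm gm).
- exact: (integrableB (measurable_itv _) fn gn).
- under eq_integral do rewrite EFinB.
  rewrite integralB// fE gE -integralB//.
Qed.

Lemma eq_same_integral (R : realType) (mu nu : probability R R) (f g : R -> R) :
  f =1 g -> same_integral mu nu f -> same_integral mu nu g.
Proof. by move=> /funext ->. Qed.

(** The polynomial has no constant term, and v^-1 times the j-th power of the exponential is the
    kernel at level j tau, with j >= 1. Induction on exponents replaces the binomial expansion. *)
Lemma laplace_poly_step (R : realType) (r tau : R) (mu nu : probability R R) :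
  0 < tau ->
  (forall t : R, 0 < t -> same_integral mu nu (laplace_kernel r t)) ->
  forall n, same_integral mu nu
    (fun v => v `^ (-1) * poly_step n (expR (- (tau * v `^ (- r))))).
Proof.
move=> tau0 same n.
pose E v := expR (- (tau * v `^ (- r))).
have mono j : (0 < j)%N -> same_integral mu nu (fun v => v `^ (-1) * E v ^+ j).
  move=> j0; apply: eq_same_integral (same (j%:R * tau) _).
    by move=> v; rewrite /E -expRM_natl mulrN mulrA.
  by rewrite mulr_gt0// ltr0n.
have monoX m j : (0 < j)%N -> same_integral mu nu
    (fun v => v `^ (-1) * (E v ^+ j * (1 - E v ^+ n.+1) ^+ m)).
  elim: m j => [|m IH] j j0.
    by apply: eq_same_integral (mono j j0) => v; rewrite expr0 mulr1.
  apply: eq_same_integral (same_integralB (IH j j0) (IH (j + n.+1)%N _)).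
    move=> v; rewrite exprD [in RHS]exprSr; ring.
  by rewrite addnS.
rewrite /poly_step; elim: (_ * _)%N => [|m IH].
  (* Exponent 0 leaves the zero function, obtained as a monomial minus itself. *)
  apply: eq_same_integral (same_integralB (mono 1%N isT) (mono 1%N isT)).
  by move=> v; rewrite expr0; ring.
(* Uses 1 - (1 - a)^(m+1) = (1 - (1 - a)^m) + a (1 - a)^m with a = E^(n+1). *)
apply: eq_same_integral (same_integralD IH (monoX m n.+1 isT)).
by move=> v; rewrite [in RHS]exprSr /E; ring.
Qed.

Lemma laplace_tail (R : realType) (r b : R) (mu nu : probability R R) :
  0 < r -> 0 < b ->
  (forall t : R, 0 < t -> same_integral mu nu (laplace_kernel r t)) ->
  (\int[mu]_(v in `]0%R, +oo[) (v `^ (-1) * \1_`[b, +oo[ v)%:E =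
   \int[nu]_(v in `]0%R, +oo[) (v `^ (-1) * \1_`[b, +oo[ v)%:E)%E.
Proof.
move=> r0 b0 same.
have ln20 : 0 < ln 2 :> R by rewrite ln_gt0// ltr1n.
(* Chosen so that the exponential equals 2 to the power - (b/v)^r, which is at least 1/2 exactly
   when v >= b. *)
pose tau := ln 2 * b `^ r.
have tau0 : 0 < tau by rewrite mulr_gt0// powR_gt0.
pose E v := expR (- (tau * v `^ (- r))).
have E01 v : 0 < E v <= 1.
  by rewrite expR_gt0/= expR_le1 oppr_le0 mulr_ge0 ?powR_ge0// ltW.
have E01' v : 0 <= E v <= 1.
  by have /andP[/ltW -> ->] := E01 v.
have EP v : 0 < v -> (2^-1 <= E v) = (b <= v).
  move=> v0; rewrite -[2^-1]lnK ?posrE ?invr_gt0//.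
  rewrite ler_expR lnV ?posrE// lerN2 /tau powRN -mulrA ger_pMr//.
  rewrite ler_pdivrMr ?powR_gt0// mul1r.
  have [bv|vb] := leP b v.
    by apply: ge0_ler_powR; rewrite ?nnegrE// ltW.
  by apply/negbTE; rewrite -ltNge; apply: gt0_ltr_powR; rewrite ?nnegrE// ltW.
pose f n v := v `^ (-1) * poly_step n (E v).
have fsame n : same_integral mu nu (f n) by exact: laplace_poly_step.
have lim (rho : probability R R) :
    (forall n, rho.-integrable `]0%R, +oo[ (EFin \o f n)) ->
    rho.-integrable `]0%R, +oo[ (EFin \o laplace_kernel r tau) ->
    (\int[rho]_(v in `]0%R, +oo[) (f n v)%:E @[n --> \oo] -->
    \int[rho]_(v in `]0%R, +oo[) (v `^ (-1) * \1_`[b, +oo[ v)%:E)%E.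
  move=> fi ki.
  have [] := @dominated_convergence _ _ _ rho `]0%R, +oo[%classic _
    (fun n v => (f n v)%:E)
    (fun v => (v `^ (-1) * \1_`[b, +oo[ v)%:E)
    (fun v => 4%:E * (laplace_kernel r tau v)%:E)%E.
  - exact: measurable_itv.
  - by move=> n; exact: measurable_int (fi n).
  - apply/measurable_EFinP; apply: measurable_funM.
      exact: measurable_funTS (measurable_powR _).
    exact: measurable_indic.
  - apply: aeW => v /=; rewrite in_itv/= andbT => v0.
    apply: cvg_EFin; first exact: nearW.
    apply: cvgMr.
    have -> : \1_`[b, +oo[ v = (2^-1 <= E v)%R%:R :> R.
      by rewrite EP// indicE mem_setE in_itv/= andbT.
    exact: poly_step_cvg.
  - exact: integrableZl.
  - apply: aeW => v n _; rewrite gee0_abs ?lee_fin; last first.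
      by rewrite mulr_ge0 ?powR_ge0//; have /andP[] := poly_step_ge0_le1 n (E01' v).
    rewrite /f /laplace_kernel mulrCA ler_wpM2l ?powR_ge0//.
    exact: poly_step_le_linear.
  by [].
have [kmu knu _] := same tau tau0.
have lmu := lim mu (fun n => let: And3 a _ _ := fsame n in a) kmu.
have lnu := lim nu (fun n => let: And3 _ a _ := fsame n in a) knu.
have fE : (fun n => \int[mu]_(v in `]0%R, +oo[) (f n v)%:E)%E =
    (fun n => \int[nu]_(v in `]0%R, +oo[) (f n v)%:E)%E.
  by apply/funext => n; have [] := fsame n.
by rewrite fE in lmu; rewrite -(cvg_lim _ lmu)// (cvg_lim _ lnu).
Qed.

(** For v >= c > 0, write 1 as v^-1 times the length of (0, v]. Tonelli then makes the tail at c an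
    integral over b > 0 of the integrals of v^-1 over v >= max(b, c), which [laplace_tail]
    identifies. *)
Lemma laplace_unique (R : realType) (r : R) (mu nu : probability R R) :
  0 < r -> mu `]0%R, +oo[%classic = 1%E -> nu `]0%R, +oo[%classic = 1%E ->
  (forall t : R, 0 < t -> same_integral mu nu (laplace_kernel r t)) ->
  forall A, measurable A -> mu A = nu A.
Proof.
move=> r0 mu1 nu1 same; apply: positive_measure_unique => // c c0.
(* Here [z.1] is v and [z.2] is b; the condition b <= v is written through v - b, so that joint
   measurability follows by composition. *)
pose f (z : R * R) : R :=
  z.1 `^ (-1) * (\1_`]0, +oo[ z.2 * \1_`[0, +oo[ (z.1 - z.2)) * \1_`[c, +oo[ z.1.
have f0 z : (0 <= (f z)%:E)%E.
  by rewrite lee_fin !mulr_ge0 ?powR_ge0// indicE.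
have mf : measurable_fun setT (fun z => (f z)%:E).
  apply/measurable_EFinP; apply: measurable_funM.
    apply: measurable_funM.
      by apply: (measurableT_comp (measurable_powR (-1))).
    apply: measurable_funM.
      exact: (measurableT_comp (measurable_indic (measurable_itv _))).
    apply: (measurableT_comp (measurable_indic (measurable_itv _))).
    exact: measurable_funB.
  exact: (measurableT_comp (measurable_indic (measurable_itv _))).
have tailE (rho : probability R R) : rho `[c, +oo[%classic =
    (\int[lebesgue_measure]_b \int[rho]_v (f (v, b))%:E)%E.
  transitivity (\int[rho]_v \int[lebesgue_measure]_b (f (v, b))%:E)%E; last first.
    exact: (@fubini_tonelli _ _ _ _ R rho lebesgue_measure (fun z => (f z)%:E) mf f0).
  rewrite -[X in rho X]setIT -integral_indic//.
  apply: eq_integral => v _.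
  have [cv|vc] := boolP (v \in `[c, +oo[%classic); last first.
    rewrite indicE (negbTE vc) integral0_eq// => b _.
    by rewrite /f /= [\1_`[c, +oo[ _]indicE (negbTE vc) mulr0.
  have v0 : 0 < v by move: cv; rewrite inE/= in_itv/= andbT; exact: lt_le_trans.
  transitivity (\int[lebesgue_measure]_b ((v^-1)%:E * (\1_`]0, v] b)%:E))%E.
    rewrite ge0_integralZl_EFin//; last 2 first.
    - by apply/measurable_EFinP; exact: measurable_indic.
    - by rewrite invr_ge0 ltW.
    have lebv : lebesgue_measure `]0%R, v]%classic = v%:E.
      by rewrite lebesgue_measure_itv/= lte_fin v0 sube0.
    rewrite integral_indic// setIT [X in (_ * X)%E]lebv.
    by rewrite -EFinM mulVf ?gt_eqF// indicE cv.
  apply: eq_integral => b _; rewrite -EFinM /f /= powR_inv1 ?ltW//.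
  rewrite [\1_`[c, +oo[ _]indicE cv mulr1 !indicE !mem_setE !in_itv/= !andbT.
  by rewrite subr_ge0; case: (0 < b); case: (b <= v); rewrite ?(mulr0, mulr1, mul0r).
rewrite !tailE; apply: eq_integral => b _.
have [b0|b0] := leP b 0.
  rewrite !integral0_eq// => v _; rewrite /f /= [\1_`]0, +oo[ _]indicE mem_setE;
    by rewrite in_itv/= andbT ltNge b0/= mul0r mulr0 mul0r.
have fE (rho : probability R R) : (\int[rho]_v (f (v, b))%:E =
   \int[rho]_(v in `]0%R, +oo[) (v `^ (-1) * \1_`[Num.max b c, +oo[ v)%:E)%E.
  rewrite [RHS]integral_mkcond; apply: eq_integral => v _.
  rewrite /f /= /patch mem_setE in_itv/= andbT !indicE !mem_setE !in_itv/= !andbT.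
  rewrite b0 subr_ge0 ge_max mul1r.
  case: (ltP 0 v) => v0.
    by case: (b <= v); case: (c <= v); rewrite ?(mulr0, mulr1, mul0r).
  (* For v <= 0 the integrand vanishes since c > 0, so restricting to v > 0 changes nothing. *)
  by rewrite [c <= v]leNgt (le_lt_trans v0 c0) mulr0.
by rewrite !fE; apply: laplace_tail r0 _ same; rewrite lt_max b0.
Qed.

(** * Small intervals under the generalized Gaussian law *)

Definition gg_constant (R : realType) (r : R) : R :=
  r / (2 `^ (1 + r^-1) * Gamma r^-1).

(** The constant is nonnegative by its form, and if it vanished the law of [X] would have total mass
    0. This avoids evaluating [Gamma]. *)
Lemma gg_constant_gt0 (R : realType) (r : R) (d : measure_display)
    (T : measurableType d) (P : probability T R) (X : {RV P >-> R}) :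
  0 < r -> gg_distributed r X -> 0 < gg_constant r.
Proof.
move=> r0 ggX; rewrite lt_neqAle; apply/andP; split.
  apply/eqP => c0; have := ggX setT measurableT.
  rewrite integral0_eq; last by move=> x _; rewrite /gg_density -/(gg_constant r) -c0 mul0r.
  move=> P0; have := etrans (esym P0) (probability_setT (distribution P X)).
  by move=> /eqP; rewrite eqe eq_sym oner_eq0.
rewrite /gg_constant divr_ge0 ?(ltW r0)// mulr_ge0 ?powR_ge0//.
by rewrite /Gamma; apply: Rintegral_ge0 => t _; rewrite mulr_ge0 ?powR_ge0 ?expR_ge0.
Qed.

Lemma integral_itv_bounds (R : realType) (f : R -> R) (a b m M : R) :
  a < b -> 0 <= m -> measurable_fun `[a, b] (EFin \o f) ->
  (forall x, a <= x <= b -> m <= f x <= M) ->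
  ((m * (b - a))%:E <= \int[lebesgue_measure]_(x in `[a, b]) (f x)%:E
     <= (M * (b - a))%:E)%E.
Proof.
move=> ab m0 mf fb.
have len : lebesgue_measure `[a, b]%classic = (b - a)%:E.
  by rewrite lebesgue_measure_itv/= lte_fin ab.
have cstE (c : R) : (c * (b - a))%:E =
    (\int[lebesgue_measure]_(x in `[a, b]) c%:E)%E.
  by rewrite integral_cst// [X in (_ * X)%E]len -EFinM.
have fb' x : `[a, b]%classic x -> m <= f x <= M by rewrite /= in_itv/=; exact: fb.
rewrite !cstE; apply/andP; split; apply: ge0_le_integral => //.
- by move=> x /fb' /andP[+ _]; rewrite lee_fin.
- by move=> x /fb' /andP[+ _]; rewrite lee_fin; exact: le_trans.
- by move=> x /fb' /andP[_]; rewrite lee_fin.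
Qed.

(** The density decreases on the positive half-line, so its endpoint values bracket it. *)
Lemma gg_interval (R : realType) (r a b : R) (d : measure_display)
    (T : measurableType d) (P : probability T R) (X : {RV P >-> R}) :
  0 < r -> gg_distributed r X -> 0 < a -> a < b ->
  ((gg_constant r * (b - a) * expR (- (b `^ r / 2)))%:E
     <= distribution P X `[a, b]
     <= (gg_constant r * (b - a) * expR (- (a `^ r / 2)))%:E)%E.
Proof.
move=> r0 ggX a0 ab; have C0 := gg_constant_gt0 r0 ggX.
have dens x : gg_density r x = gg_constant r * expR (- (`|x| `^ r / 2)) by [].
have dens0 x : 0 <= gg_density r x by rewrite dens mulr_ge0 ?expR_ge0// ltW.
have mdens : measurable_fun `[a, b] (fun x => (gg_density r x)%:E).
  apply/measurable_EFinP; apply: (@measurable_funS _ _ _ _ setT) => //.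
  apply: measurable_funM => //; apply: measurableT_comp => //.
  apply: measurableT_comp => //; apply: measurable_funM => //.
  by apply: (measurableT_comp (measurable_powR r)).
have mono x y : 0 <= x -> x <= y -> expR (- (y `^ r / 2)) <= expR (- (x `^ r / 2)).
  move=> x0 xy; rewrite ler_expR lerN2 ler_pM2r//.
  by apply: ge0_ler_powR; rewrite ?nnegrE ?(ltW r0)// (le_trans x0).
have distE : distribution P X `[a, b] =
    (\int[lebesgue_measure]_(x in `[a, b]) (gg_density r x)%:E)%E.
  exact: ggX.
move: (gg_constant r) (gg_density r) C0 dens dens0 mdens distE.
move=> C g C0 dens dens0 mdens distE.
have cM e : C * (b - a) * e = C * e * (b - a) by ring.
rewrite distE !cM; apply: integral_itv_bounds => //.
- by rewrite mulr_ge0 ?expR_ge0// ltW.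
- move=> x /andP[ax xb]; have x0 : 0 <= x by rewrite (le_trans _ ax)// ltW.
  rewrite dens ger0_norm//; apply/andP; split; apply: ler_wpM2l (ltW C0) _ _ _.
    exact: mono.
  exact: mono (ltW a0) ax.
Qed.

Lemma bounded_measurable_indic (R : realType) (A : set R) :
  measurable A -> bounded_measurable (\1_A : R -> R).
Proof.
move=> mA; apply/bounded_measurableP; split; first exact: measurable_indic.
by exists 1 => x; rewrite indicE; case: (_ \in _); rewrite ?normr1 ?normr0.
Qed.

(** After Tonelli, y <= v X <= z becomes y/v <= X <= z/v for v > 0, and the other v form a null set.
    Measurability in v is recorded for the later comparison of integrals. *)
Lemma factor_operator_interval (R : realType) (mu : probability R R) (y z : R)
    (d : measure_display) (T : measurableType d) (P : probability T R)
    (X : {RV P >-> R}) : mu `]0%R, +oo[%classic = 1%E ->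
  measurable_fun (`]0, +oo[%classic : set R) (fun v : R => distribution P X `[y / v, z / v]) /\
  (\int[P]_w (factor_operator mu \1_`[y, z] (X w))%:E =
   \int[mu]_(v in `]0%R, +oo[) distribution P X `[(y / v)%R, (z / v)%R])%E.
Proof.
move=> mu1.
have mu0 : mu (~` `]0%R, +oo[) = 0%E by rewrite probability_setC// mu1 subee.
have bh := @bounded_measurable_indic R `[y, z]%classic (measurable_itv _).
have bK : bounded_measurable (factor_operator mu \1_`[y, z]).
  by have [+ _ _ _] := factor_operator_markov mu; exact.
pose f (u : R * R) := ((\1_`[y, z] (u.1 * u.2) : R)%:E).
have mf : measurable_fun setT f.
  apply/measurable_EFinP; apply: (@measurableT_comp _ _ _ _ _ _ (\1_`[y, z] : R -> R)).
    by case: bh.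
  exact: measurable_funM.
have f0 u : (0 <= f u)%E by rewrite lee_fin indicE.
have mF := @measurable_fun_fubini_tonelli_F _ _ _ _ R (distribution P X) f mf f0.
have FE v : v \in (`]0, +oo[%classic : set R) ->
    fubini_F (distribution P X) f v = distribution P X `[y / v, z / v].
  rewrite inE/= in_itv/= andbT => v0.
  transitivity (\int[distribution P X]_x (\1_`[y / v, z / v] x)%:E)%E; last first.
    by rewrite integral_indic// setIT.
  apply: eq_integral => x _; rewrite /f /= !indicE !mem_setE !in_itv/=.
  by rewrite ler_pdivrMr// ler_pdivlMr// ![v * x]mulrC.
split; first exact: (eq_measurable_fun _ FE (measurable_funTS mF)).
rewrite (law_integral (mu := distribution P X) _ bK)//.
transitivity (\int[distribution P X]_x \int[mu]_v f (v, x))%E.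
  by apply: eq_integral => x _; rewrite factor_operatorE.
rewrite -(@fubini_tonelli _ _ _ _ R mu (distribution P X) f mf f0).
transitivity (\int[mu]_(v in `]0%R, +oo[ `|` ~` `]0%R, +oo[)
    fubini_F (distribution P X) f v)%E; first by rewrite setUv.
rewrite ge0_integral_setU//=; last 4 first.
- exact: measurableC.
- by rewrite setUv.
- by move=> v _; exact: integral_ge0.
- by apply/disj_set2P; rewrite setICr.
rewrite [X in (_ + X)%E](null_set_integral _ _ mu0)//; last 2 first.
- exact: measurableC.
- exact: measurable_funTS.
by rewrite adde0; apply: eq_integral => v /FE.
Qed.

(** The interval [y/v, z/v] has length (z - y)/v, which yields the factor v^-1 of the kernel; the
    density at its endpoints yields the two exponentials. *)
Lemma laplace_sandwich (R : realType) (r y z : R) (mu : probability R R)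
    (d : measure_display) (T : measurableType d) (P : probability T R)
    (X : {RV P >-> R}) : 0 < r -> gg_distributed r X ->
  mu `]0%R, +oo[%classic = 1%E -> 0 < y -> y < z ->
  ((gg_constant r * (z - y))%:E *
     \int[mu]_(v in `]0%R, +oo[) (laplace_kernel r (z `^ r / 2) v)%:E
   <= \int[P]_w (factor_operator mu \1_`[y, z] (X w))%:E
   <= (gg_constant r * (z - y))%:E *
     \int[mu]_(v in `]0%R, +oo[) (laplace_kernel r (y `^ r / 2) v)%:E)%E.
Proof.
move=> r0 ggX mu1 y0 yz; have z0 := lt_trans y0 yz.
have [mD ->] := @factor_operator_interval R mu y z d T P X mu1.
have C0 := gg_constant_gt0 r0 ggX.
have Czy : 0 <= gg_constant r * (z - y) by rewrite mulr_ge0 ?subr_ge0 ?ltW.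
have interval v : 0 < v -> ((gg_constant r * (z - y) * laplace_kernel r (z `^ r / 2) v)%:E
    <= distribution P X `[(y / v)%R, (z / v)%R]
    <= (gg_constant r * (z - y) * laplace_kernel r (y `^ r / 2) v)%:E)%E.
  move=> v0; have kE x : 0 < x ->
      gg_constant r * (z - y) * laplace_kernel r (x `^ r / 2) v =
      gg_constant r * (z / v - y / v) * expR (- ((x / v) `^ r / 2)).
    move=> x0; rewrite /laplace_kernel powR_inv1 ?ltW// -mulrBl.
    rewrite [(x / v) `^ r]powRM ?invr_ge0 ?ltW// -[v^-1 in RHS]powR_inv1 ?ltW//.
    rewrite -powRrM mulN1r powR_inv1 ?ltW// [x `^ r / 2 * _]mulrAC; ring.
  rewrite !kE//; apply: gg_interval => //; first by rewrite divr_gt0.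
  by rewrite ltr_pM2r ?invr_gt0.
move: (gg_constant r) (z `^ r / 2) (y `^ r / 2) C0 Czy interval.
move=> C t s C0 Czy interval.
have mk x : measurable_fun (`]0, +oo[%classic : set R) (fun v => (laplace_kernel r x v)%:E).
  by apply/measurable_EFinP; exact: measurable_laplace_kernel.
have mCk x : measurable_fun (`]0, +oo[%classic : set R)
    (fun v => ((C * (z - y))%:E * (laplace_kernel r x v)%:E)%E).
  exact: emeasurable_funM.
have k0 x v : (0 <= (laplace_kernel r x v)%:E)%E.
  by rewrite lee_fin laplace_kernel_ge0.
have ZE x : ((C * (z - y))%:E *
    \int[mu]_(v in `]0%R, +oo[) (laplace_kernel r x v)%:E =
    \int[mu]_(v in `]0%R, +oo[)
      ((C * (z - y))%:E * (laplace_kernel r x v)%:E))%E.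
  by rewrite (ge0_integralZl_EFin mu (measurable_itv _) _ (mk x)).
rewrite (ZE t) (ZE s).
apply/andP; split; apply: ge0_le_integral => //.
- by move=> v _; rewrite mule_ge0// lee_fin.
- by move=> v /=; rewrite in_itv/= andbT -EFinM => /interval /andP[].
- by move=> v /=; rewrite in_itv/= andbT -EFinM => /interval /andP[].
Qed.

(** * Uniqueness of scale mixtures *)

Lemma scale_mixture_unique (R : realType) (r : R) (mu nu : probability R R)
    (d : measure_display) (T : measurableType d) (P : probability T R)
    (X : {RV P >-> R}) : 0 < r -> gg_distributed r X ->
  mu `]0%R, +oo[%classic = 1%E -> nu `]0%R, +oo[%classic = 1%E ->
  (forall h, bounded_measurable h ->
    \int[P]_w (factor_operator mu h (X w))%:E =
    \int[P]_w (factor_operator nu h (X w))%:E)%E ->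
  forall A, measurable A -> mu A = nu A.
Proof.
move=> r0 ggX mu1 nu1 munu.
have C0 := gg_constant_gt0 r0 ggX.
have [z [z_gt0 z_lt zE]] : exists z : R -> R,
    [/\ forall s, 0 < s -> 0 < z s, forall s t, 0 < s -> s < t -> z s < z t &
        forall s, 0 < s -> z s `^ r / 2 = s].
  (* The endpoint z is reparametrized by the Laplace level s, solving z^r / 2 = s. *)
  exists (fun s => (2 * s) `^ r^-1); split=> [s s0|s t s0 st|s s0].
  - by rewrite powR_gt0 ?mulr_gt0.
  - apply: gt0_ltr_powR; rewrite ?invr_gt0// ?nnegrE ?mulr_ge0 ?ltW//.
      exact: lt_trans st.
    by rewrite ltr_pM2l.
  - rewrite -powRrM mulVf ?gt_eqF// powRr1 ?mulr_ge0 ?ltW//.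
    by rewrite mulrC mulKf.
pose c s t := gg_constant r * (z t - z s).
have c0 s t : 0 < s -> s < t -> 0 < c s t.
  by move=> s0 st; rewrite mulr_gt0// subr_gt0 z_lt.
pose L (rho : probability R R) t :=
  (\int[rho]_(v in `]0%R, +oo[) (laplace_kernel r t v)%:E)%E.
pose M (rho : probability R R) s t :=
  (\int[P]_w (factor_operator rho \1_`[z s, z t] (X w))%:E)%E.
have sandwich (rho : probability R R) (s t : R) : rho `]0%R, +oo[%classic = 1%E ->
    0 < s -> s < t ->
    ((c s t)%:E * L rho t <= M rho s t <= (c s t)%:E * L rho s)%E.
  move=> rho1 s0 st; have t0 := lt_trans s0 st.
  have := laplace_sandwich r0 ggX rho1 (z_gt0 s s0) (z_lt s t s0 st).
  by rewrite !zE.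
have bind y x := @bounded_measurable_indic R `[y, x]%classic (measurable_itv _).
have bK (rho : probability R R) y x :
    bounded_measurable (factor_operator rho \1_`[y, x]).
  by have [+ _ _ _] := factor_operator_markov rho; apply; exact: bind.
have L0 rho t : (0 <= L rho t)%E.
  by apply: integral_ge0 => v _; rewrite lee_fin laplace_kernel_ge0.
have Lfin (rho : probability R R) (t : R) : rho `]0%R, +oo[%classic = 1%E -> 0 < t ->
    (L rho t < +oo)%E.
  move=> rho1 t0; have t2 : t / 2 < t by lra.
  have t20 : 0 < t / 2 by lra.
  have /andP[+ _] := sandwich rho _ _ rho1 t20 t2.
  have : (M rho (t / 2)%R t < +oo)%E.
    rewrite ltey_eq; apply/orP; left; apply: integrable_fin_num => //.
    exact: bounded_measurable_integrable.
  (* An infinite transform at t would make the lower bound of the finite mass [M rho (t / 2) t]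
     infinite, as its coefficient is positive. *)
  have := L0 rho t; case: (L rho t) => [x _ _ _|_|//]; first exact: ltry.
  by rewrite gt0_muley ?lte_fin ?c0// => /[swap] /le_lt_trans; apply.
have Lint (rho : probability R R) (t : R) : rho `]0%R, +oo[%classic = 1%E -> 0 < t ->
    rho.-integrable `]0%R, +oo[ (EFin \o laplace_kernel r t).
  move=> rho1 t0; apply/integrableP; split.
    by apply/measurable_EFinP; exact: measurable_laplace_kernel.
  rewrite (le_lt_trans _ (Lfin rho t rho1 t0))// le_eqVlt; apply/orP; left.
  apply/eqP/eq_integral => v _; rewrite gee0_abs// lee_fin.
  exact: laplace_kernel_ge0.
have Lle (rho sigma : probability R R) : rho `]0%R, +oo[%classic = 1%E ->
    sigma `]0%R, +oo[%classic = 1%E -> (forall s t, M rho s t = M sigma s t) ->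
    forall t : R, 0 < t -> (L rho t <= L sigma t)%E.
  move=> rho1 sigma1 ME; apply: laplace_le => [t|s t s0 st]; first exact: Lint.
  have /andP[le1 _] := sandwich rho _ _ rho1 s0 st.
  have /andP[_ le2] := sandwich sigma _ _ sigma1 s0 st.
  (* The two sandwiches share their middle term, and their common positive coefficient cancels. *)
  have := le_trans le1 (le_trans _ le2); rewrite ME => /(_ (lexx _)).
  by rewrite lee_pmul2l// lte_fin c0.
have ME s t : M mu s t = M nu s t by exact/munu/bind.
apply: (laplace_unique r0 mu1 nu1) => t t0; split; [exact: Lint..|].
by apply/eqP; rewrite eq_le; apply/andP; split; apply: Lle.
Qed.

(** * Composition of factor laws and the final statement *)

Lemma eq_factor_operator (R : realType) (mu nu : probability R R) h x :
  (forall A, measurable A -> mu A = nu A) ->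
  factor_operator mu h x = factor_operator nu h x.
Proof.
move=> munu; rewrite /factor_operator unlock; congr fine.
by apply: eq_measure_integral => A mA _; exact: munu.
Qed.

(** Both the product law [rho] and [mu_pr] mix the scales of X_r into the law of X_p, so they
    coincide. The variables X_p, X_q and X_r are taken from the factor laws themselves. *)
Lemma factor_operator_semigroup (R : realType) (p q r : R)
    (mu_pq mu_qr mu_pr : probability R R) (h : R -> R) (x : R) :
  0 < r -> factor_law p q mu_pq -> factor_law q r mu_qr ->
  factor_law p r mu_pr -> bounded_measurable h ->
  factor_operator mu_qr (factor_operator mu_pq h) x = factor_operator mu_pr h x.
Proof.
move=> r0 fpq fqr fpr bh.
have [d [T [P [_ [Xr [Xq [_ _ ggXr _ [ggXq _]]]]]]]] := fqr.
have [d' [T' [P' [_ [_ [Xp [_ _ _ _ [ggXp _]]]]]]]] := fpr.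
have [rho rho1 rhoE] :=
  factor_operator_comp (factor_law_pos fpq) (factor_law_pos fqr).
rewrite -rhoE//; apply: eq_factor_operator.
apply: (scale_mixture_unique r0 ggXr rho1 (factor_law_pos fpr)) => g bg.
rewrite -(factor_law_integral fpr ggXp ggXr bg).
rewrite (factor_law_integral fpq ggXp ggXq bg).
rewrite (factor_law_integral fqr ggXq ggXr); last first.
  by have [+ _ _ _] := factor_operator_markov mu_pq; exact.
by apply: eq_integral => w _; rewrite rhoE.
Qed.

Theorem proposition1 (R : realType) :
  (forall (p q : R) (mu : probability R R),
     0 < p -> p <= q -> factor_law p q mu ->
     markov_operator (factor_operator mu) /\
     (forall (d1 : measure_display) (T1 : measurableType d1)
        (P1 : probability T1 R) (Xp : {RV P1 >-> R})
        (d2 : measure_display) (T2 : measurableType d2)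
        (P2 : probability T2 R) (Xq : {RV P2 >-> R}),
        gg_distributed p Xp -> gg_distributed q Xq ->
        forall h : R -> R, bounded_measurable h ->
        ('E_P1[(fun w => h (Xp w))] =
         'E_P2[(fun w => factor_operator mu h (Xq w))])%E))
  /\
  (forall (p q r : R) (mu_pq mu_qr mu_pr : probability R R),
     0 < p -> p <= q -> q <= r ->
     factor_law p q mu_pq -> factor_law q r mu_qr -> factor_law p r mu_pr ->
     forall h : R -> R, bounded_measurable h ->
     (forall x, factor_operator mu_qr (factor_operator mu_pq h) x =
                factor_operator mu_pr h x) /\
     (forall (d : measure_display) (T : measurableType d)
        (P : probability T R) (Vpq Vqr : {RV P >-> R}),
        has_law Vpq mu_pq -> has_law Vqr mu_qr -> independent Vpq Vqr ->
        forall x, factor_operator mu_qr (factor_operator mu_pq h) x =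
                  fine ('E_P[(fun w => h (Vpq w * Vqr w * x)%R)])%E)).
Proof.
split=> [p q mu p0 pq fpq|p q r mu_pq mu_qr mu_pr p0 pq qr fpq fqr fpr h bh].
  split; first exact: factor_operator_markov.
  move=> d1 T1 P1 Xp d2 T2 P2 Xq ggXp ggXq h bh; rewrite unlock.
  exact: (factor_law_integral fpq ggXp ggXq bh).
split=> [x|d T P Vpq Vqr lpq lqr ind x].
  apply: factor_operator_semigroup fpq fqr fpr bh.
  exact: lt_le_trans (le_trans pq qr).
have bhx := bounded_measurable_scale x bh.
rewrite unlock (independent_integral_mul lpq lqr ind bhx).
rewrite {1}/factor_operator unlock; congr fine.
by apply: eq_integral => v _; rewrite factor_operator_scale.
Qed.
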